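(* Let $1<p<\infty$ be fixed and let $(\lambda_n)_{n\ge 1}$ be a sequence of real numbers with $\lambda_n>0$ for all $n\geq 1$. Put $\Lambda_n=\sum_{i=1}^n\lambda_i$, and let $A=(a_{n,k})_{n,k\ge 1}$ be the weighted mean matrix given by $a_{n,k}=\lambda_k/\Lambda_n$ for $1\le k\le n$ and $a_{n,k}=0$ for $k>n$. Suppose there exists a constant $L$ with $0<L<p$ such that for every integer $n\ge 1$, $$\frac{\Lambda_{n+1}}{\lambda_{n+1}}\le \frac{\Lambda_n}{\lambda_n}\Big(1-\frac{L\lambda_n}{p\Lambda_n}\Big)^{1-p}+\frac{L}{p}.$$ Then $\|A\|_{p,p}\le \dfrac{p}{p-L}$.
   Context: For $p\ge 1$, $l^p$ is the Banach space of complex sequences $\mathbf{a}=(a_n)_{n\ge1}$ with norm $\|\mathbf{a}\|_p=\big(\sum_{n=1}^\infty |a_n|^p\big)^{1/p}<\infty$. For an infinite matrix $C=(c_{n,k})$, $C\cdot\mathbf{a}$ is the sequence with $n$-th term $\sum_{k} c_{n,k}a_k$, and $\|C\|_{p,p}=\sup_{\|\mathbf{a}\|_p\le 1}\|C\cdot\mathbf{a}\|_p$. Thus $\|A\|_{p,p}\le U^{1/p}$ means that $\sum_{n=1}^\infty\big|\sum_{k=1}^n \frac{\lambda_k}{\Lambda_n}a_k\big|^p\le U\sum_{n=1}^\infty|a_n|^p$ for all $\mathbf{a}\in l^p$. *)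

(* Defs.v *)
From mathcomp Require Import all_boot all_order all_algebra complex.
From mathcomp Require Import all_classical all_reals all_analysis.
Import Order.TTheory GRing.Theory Num.Theory numFieldNormedType.Exports.

Set Implicit Arguments.
Unset Strict Implicit.
Unset Printing Implicit Defensive.

Local Open Scope ring_scope.
Local Open Scope classical_set_scope.
Local Open Scope complex_scope.

(* Sequences and infinite matrices are indexed by the integers n >= 1: they are
   functions on nat whose values at index 0 are never used. *)

(* The value is +oo exactly when [a] is not in l^p. *)
Definition lp_norm (R : realType) (p : R) (a : nat -> R[i]) : \bar R :=
  ((\sum_(1 <= n <oo) (ComplexField.Normc.normc (a n) `^ p)%:E) `^ p^-1)%E.

(* [^o] selects the topology of R[i] given by the modulus.  [limn] returns an
   unspecified value when the series diverges; this cannot happen for a matrix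
   whose rows have finitely many nonzero entries. *)
Definition mx_apply (R : realType) (C : nat -> nat -> R[i]) (a : nat -> R[i])
    (n : nat) : R[i] :=
  limn (fun N => (\sum_(1 <= k < N) C n k * a k : R[i]^o)).

Definition lp_opnorm (R : realType) (p : R) (C : nat -> nat -> R[i]) : \bar R :=
  ereal_sup [set lp_norm p (mx_apply C a) |
             a in [set a : nat -> R[i] | (lp_norm p a <= 1)%E]].

Definition psum (R : realType) (lambda : nat -> R) (n : nat) : R :=
  \sum_(1 <= i < n.+1) lambda i.

Definition weighted_mean_mx (R : realType) (lambda : nat -> R) (n k : nat)
    : R[i] :=
  if (1 <= k <= n)%N then (lambda k / psum lambda n)%:C else 0.

(* Main.v *)
(* With [c = L / p], [x n = psum n / lambda n] and [M n] the weighted mean of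
   nonnegative [b 1, .., b n], one has
     x n * M n = b n + (x n - 1) * M (n - 1).
   Convexity of the [p]-th power turns the hypothesis on [x] into
     (x (n + 1) - c) (M n)^p
     <= (1 - c)^(1 - p) (b n)^p + (x n - 1) (M (n - 1))^p.
   Since [x 1 = 1], summing over [n] telescopes to
     (1 - c) \sum (M n)^p <= (1 - c)^(1 - p) \sum (b n)^p,
   and [(1 - c)^-1 = p / (p - L)]. *)

Require Import Defs.
From mathcomp Require Import all_boot all_order all_algebra complex.
From mathcomp Require Import all_classical all_reals all_analysis.
From mathcomp Require Import ring lra.
Import Order.TTheory GRing.Theory Num.Theory numFieldNormedType.Exports.

Local Open Scope ring_scope.

(** Jensen's inequality for [t]^ p[with the normalized weights]v / (v + w)[and]w / (v +
    w)[, scaled by](v + w) [^ p]. *)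
Lemma powR_weighted_sum_le (R : realType) (p v w a b : R) :
  1 <= p -> 0 <= v -> 0 <= w -> 0 < v + w -> 0 <= a -> 0 <= b ->
  (v * a + w * b) `^ p <= (v + w) `^ (p - 1) * (v * a `^ p + w * b `^ p).
Proof.
move=> p1 v0 w0 vw0 a0 b0.
have t0 : 0 <= v / (v + w) by rewrite divr_ge0// ltW.
have t1 : v / (v + w) <= 1 by rewrite ler_pdivrMr// mul1r lerDl.
have conv : (v / (v + w) * a + w / (v + w) * b) `^ p
    <= v / (v + w) * a `^ p + w / (v + w) * b `^ p.
  have -> : w / (v + w) = 1 - v / (v + w) by field; rewrite gt_eqF.
  have := @convex_powR R p p1 (Itv01 t0 t1) a b.
  by rewrite !convRE /=; apply; rewrite inE/= in_itv/= andbT.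
have -> : v * a + w * b = (v + w) * (v / (v + w) * a + w / (v + w) * b).
  by field; rewrite gt_eqF.
rewrite powRM; [|exact: ltW|by rewrite addr_ge0 ?mulr_ge0 ?invr_ge0 ?(ltW vw0)].
rewrite -(mulr_powRB1 (ltW vw0) (lt_le_trans ltr01 p1)).
rewrite mulrAC mulrC; apply: ler_wpM2l; first exact: powR_ge0.
apply: le_trans (ler_wpM2l (ltW vw0) conv) _.
by rewrite le_eqVlt; apply/orP; left; apply/eqP; field; rewrite gt_eqF.
Qed.

(* The convexity weights [1 - c] and [x - 1] are the ones whose sum is [x - c],
   so that [hyp] bounds the resulting factor by [y - c]. *)
Lemma weighted_mean_step (R : realType) (p c x y a b : R) :
  1 < p -> 0 < c -> c < 1 -> 1 <= x -> 0 <= a -> 0 <= b ->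
  y <= x * (1 - c / x) `^ (1 - p) + c ->
  (y - c) * ((a + (x - 1) * b) / x) `^ p
  <= (1 - c) `^ (1 - p) * a `^ p + (x - 1) * b `^ p.
Proof.
move=> p1 c0 c1 x1 a0 b0 hyp.
have x0 : 0 < x by lra.
have xc : 0 < x - c by lra.
have s0 : 0 <= a + (x - 1) * b by rewrite addr_ge0// mulr_ge0//; lra.
have negE (z : R) : z `^ (1 - p) = (z `^ (p - 1))^-1 by rewrite -powRN opprB.
have factorE : x * (1 - c / x) `^ (1 - p) = x `^ p / (x - c) `^ (p - 1).
  have -> : 1 - c / x = (x - c) / x by field; rewrite gt_eqF.
  rewrite negE powRM; [|exact: ltW|by rewrite invr_ge0 ltW].
  rewrite -(powR_inv1 (ltW x0)).
  rewrite -powRrM mulN1r powRN -(mulr_powRB1 (ltW x0) (lt_trans ltr01 p1)).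
  by field; rewrite !gt_eqF ?powR_gt0.
apply: (@le_trans _ _ (x `^ p / (x - c) `^ (p - 1)
    * ((a + (x - 1) * b) / x) `^ p)).
  by apply: ler_wpM2r; [exact: powR_ge0|rewrite -factorE; lra].
have -> : x `^ p / (x - c) `^ (p - 1) * ((a + (x - 1) * b) / x) `^ p
    = (a + (x - 1) * b) `^ p / (x - c) `^ (p - 1).
  have -> : a + (x - 1) * b = x * ((a + (x - 1) * b) / x).
    by field; rewrite gt_eqF.
  rewrite (powRM _ (ltW x0)); last first.
    by rewrite mulr_ge0 ?invr_ge0 ?(ltW x0)// mulrC divfK ?gt_eqF.
  rewrite [x * (_ / x)]mulrC divfK ?gt_eqF//.
  by rewrite mulrAC.
rewrite ler_pdivrMr ?powR_gt0// [leRHS]mulrC.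
(* Dividing [a] by its weight [1 - c] leaves the combination equal to [a + (x - 1) * b]. *)
have := @powR_weighted_sum_le R p (1 - c) (x - 1) (a / (1 - c)) b.
have -> : 1 - c + (x - 1) = x - c by ring.
have -> : (1 - c) * (a / (1 - c)) = a by field; rewrite gt_eqF //; lra.
have -> : (1 - c) * (a / (1 - c)) `^ p = (1 - c) `^ (1 - p) * a `^ p.
  have d0 : 0 < 1 - c by lra.
  rewrite powRM ?invr_ge0 ?(ltW d0)// -(powR_inv1 (ltW d0))//.
  rewrite -powRrM mulN1r powRD; last by rewrite (gt_eqF d0) implybT.
  by rewrite powRr1 ?(ltW d0)//; ring.
apply; [lra|lra|lra|lra| |lra].
by rewrite divr_ge0//; lra.
Qed.

Section WeightedMean.
Variables (R : realType) (lambda : nat -> R).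
Hypothesis lambda_gt0 : forall n : nat, (1 <= n)%N -> 0 < lambda n.

(** Real analogue of the matrix action, meant for sequences of moduli. At [n = 0] its value is
    [0 / 0 = 0]. *)
Definition weighted_mean (b : nat -> R) (n : nat) : R :=
  (\sum_(1 <= k < n.+1) lambda k * b k) / psum lambda n.

Lemma psumS n : psum lambda n.+1 = psum lambda n + lambda n.+1.
Proof. by rewrite /psum big_nat_recr. Qed.

Lemma psum0 : psum lambda 0 = 0.
Proof. by rewrite /psum big_geq. Qed.

Lemma psum_ge0 n : 0 <= psum lambda n.
Proof.
by elim: n => [|n ih]; rewrite ?psum0 // psumS addr_ge0// ltW// lambda_gt0.
Qed.

Lemma psum_gt0 n : 0 < psum lambda n.+1.
Proof. by rewrite psumS ltr_wpDl ?psum_ge0// lambda_gt0. Qed.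

Lemma weighted_mean_ge0 b n : (forall k, 0 <= b k) -> 0 <= weighted_mean b n.
Proof.
move=> b0; rewrite divr_ge0 ?psum_ge0// big_nat; apply: sumr_ge0 => k.
by move=> /andP[k1 _]; rewrite mulr_ge0// ltW// lambda_gt0.
Qed.

(** Split off the last term of the weighted sum and divide by [lambda n.+1]. At [n = 0] the
    coefficient [x - 1] vanishes. *)
Lemma weighted_meanS b n (x := psum lambda n.+1 / lambda n.+1) :
  weighted_mean b n.+1 = (b n.+1 + (x - 1) * weighted_mean b n) / x.
Proof.
have l0 : 0 < lambda n.+1 by exact: lambda_gt0.
have P0 := psum_gt0 n.
have -> : x - 1 = psum lambda n / lambda n.+1.
  by rewrite /x psumS; field; rewrite gt_eqF.
rewrite /weighted_mean big_nat_recr//= /x.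
(* [n = 0] is separate because [psum lambda 0 = 0] cannot be cancelled. *)
case: n l0 P0 @x => [|n] l0 P0 x.
  by rewrite psum0 big_geq// !mul0r; field; rewrite !gt_eqF.
have P1 := psum_gt0 n; move: (psum lambda n.+1) (psum lambda n.+2) P0 P1 @x.
by move=> P Q Q0 P0 x; field; rewrite !gt_eqF.
Qed.

Lemma sum_weighted_mean_powR_le (p L : R) (b : nat -> R) N :
  1 < p -> 0 < L -> L < p ->
  (forall n : nat, (1 <= n)%N ->
     psum lambda n.+1 / lambda n.+1
     <= psum lambda n / lambda n
          * (1 - L * lambda n / (p * psum lambda n)) `^ (1 - p) + L / p) ->
  (forall k, 0 <= b k) ->
  \sum_(1 <= n < N.+1) weighted_mean b n `^ p
  <= (p / (p - L)) `^ p * \sum_(1 <= n < N.+1) b n `^ p.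
Proof.
move=> p1 L0 Lp hL b0.
pose c := L / p; pose x n := psum lambda n / lambda n.
have p0 : 0 < p by lra.
have c0 : 0 < c by rewrite divr_gt0.
have c1 : c < 1 by rewrite ltr_pdivrMr// mul1r.
have x1 n : 1 <= x n.+1.
  by rewrite ler_pdivlMr ?lambda_gt0// mul1r psumS lerDr psum_ge0.
(* The boundary term carries the induction; being nonnegative, it is dropped at the end. *)
have telescoped : (1 - c) * \sum_(1 <= n < N.+1) weighted_mean b n `^ p
    + (x N.+1 - 1) * weighted_mean b N `^ p
    <= (1 - c) `^ (1 - p) * \sum_(1 <= n < N.+1) b n `^ p.
  elim: N => [|N ih].
    rewrite !big_geq// !mulr0 add0r /x psumS psum0 add0r.
    by rewrite divff ?subrr ?mul0r// gt_eqF// lambda_gt0.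
  have step : (x N.+2 - c) * weighted_mean b N.+1 `^ p
      <= (1 - c) `^ (1 - p) * b N.+1 `^ p
         + (x N.+1 - 1) * weighted_mean b N `^ p.
    rewrite weighted_meanS; apply: weighted_mean_step => //; first exact: x1.
      exact: weighted_mean_ge0.
    have := hL N.+1 isT; rewrite -/(x N.+2) -/(x N.+1) -/c.
    congr (_ <= _ * (1 - _) `^ _ + _).
    by rewrite /c /x; field; rewrite !gt_eqF ?psum_gt0 ?lambda_gt0.
  (* Split [x N.+2 - c] as [(1 - c) + (x N.+2 - 1)]: the new summand plus the new boundary term. *)
  by rewrite !(big_nat_recr N.+1)//= !mulrDr; lra.
have d0 : 0 < 1 - c by lra.
have KE : (p / (p - L)) `^ p = (1 - c) `^ (1 - p) / (1 - c).
  have -> : p / (p - L) = (1 - c)^-1.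
    by rewrite /c; field; rewrite gt_eqF//= gt_eqF//; lra.
  rewrite -(powR_inv1 (ltW d0))// -powRrM mulN1r -powRD.
    by congr (_ `^ _); ring.
  by rewrite (gt_eqF d0) implybT.
rewrite KE mulrAC ler_pdivlMr// mulrC (le_trans _ telescoped)// lerDl.
by rewrite mulr_ge0 ?powR_ge0 ?subr_ge0.
Qed.

(** Row [n] vanishes beyond column [n], so the partial sums are constant from [N = n.+1] on. *)
Lemma mx_apply_weighted_mean (a : nat -> R[i]) n :
  mx_apply (weighted_mean_mx lambda) a n
  = \sum_(1 <= k < n.+1) (lambda k / psum lambda n)%:C%C * a k.
Proof.
apply: (@lim_near_cst R[i]^o (@norm_hausdorff R[i] R[i]^o)).
exists n.+1 => // N /= nN.
rewrite (@big_cat_nat _ _ _ n.+1)//= [X in _ + X]big_nat_cond.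
rewrite [X in _ + X]big1 ?addr0 => [|k /andP[/andP[nk _] _]]; last first.
  by rewrite /weighted_mean_mx [(k <= n)%N]leqNgt nk andbF mul0r.
apply: eq_big_nat => k /andP[k1 kn].
by rewrite /weighted_mean_mx k1 -ltnS kn.
Qed.

(** Triangle inequality; the weights are nonnegative reals, hence equal to their moduli. *)
Lemma normc_mx_apply_weighted_mean_le (a : nat -> R[i]) n :
  ComplexField.Normc.normc (mx_apply (weighted_mean_mx lambda) a n)
  <= weighted_mean (fun k => ComplexField.Normc.normc (a k)) n.
Proof.
rewrite mx_apply_weighted_mean /weighted_mean mulr_suml !big_nat.
elim/big_ind2 : _ => [|z r w s zr ws|k /andP[k1 _]].
- by rewrite ComplexField.Normc.normc0.
- by apply: le_trans (lerD zr ws); exact: le_normcD.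
- rewrite ComplexField.Normc.normcM /= expr0n addr0 sqrtr_sqr ger0_norm.
    by rewrite mulrAC.
  by rewrite divr_ge0 ?psum_ge0// ltW// lambda_gt0.
Qed.

End WeightedMean.

Theorem theorem1p2 (R : realType) (p : R) (hp : 1 < p)
    (lambda : nat -> R) (hlambda : forall n : nat, (1 <= n)%N -> 0 < lambda n)
    (L : R) (hL0 : 0 < L) (hLp : L < p)
    (hL : forall n : nat, (1 <= n)%N ->
       psum lambda n.+1 / lambda n.+1
       <= psum lambda n / lambda n
            * (1 - L * lambda n / (p * psum lambda n)) `^ (1 - p)
          + L / p) :
  (lp_opnorm p (weighted_mean_mx lambda) <= (p / (p - L))%:E)%E.
Proof.
apply: ge_ereal_sup => _ [a /= a1 <-].
have p0 : 0 < p by lra.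
pose b k := ComplexField.Normc.normc (a k).
have b0 k : 0 <= b k by rewrite /b; case: (a k) => ? ?; exact: sqrtr_ge0.
have U0 : 0 <= p / (p - L) by rewrite divr_ge0//; lra.
have sum1 N : \sum_(1 <= n < N.+1) b n `^ p <= 1.
  have S0 : (0 <= \sum_(1 <= n <oo) (b n `^ p)%:E)%E.
    by apply: nneseries_ge0 => n _ _; rewrite lee_fin powR_ge0.
  have S1 : (\sum_(1 <= n <oo) (b n `^ p)%:E <= 1)%E.
    rewrite -(poweRe1 S0) -[X in (_ `^ X <= _)%E](mulVf (lt0r_neq0 p0)).
    rewrite poweRrM -(poweR1r p).
    apply: (gt0_ler_poweR (ltW p0)) a1; rewrite in_itv/= leey andbT ?lee01//.
    exact: poweR_ge0.
  rewrite -lee_fin -sumEFin (le_trans _ S1)//.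
  by apply: nneseries_lim_ge => n _ _; rewrite lee_fin powR_ge0.
rewrite /lp_norm.
(* With both sides [p]-th roots, it remains to bound the series, and hence each of its partial
   sums. *)
have -> : (p / (p - L))%:E = (((p / (p - L)) `^ p)%:E `^ p^-1)%E.
  by rewrite poweR_EFin -powRrM mulfV ?gt_eqF// powRr1.
apply: gt0_ler_poweR.
- by rewrite invr_ge0 ltW.
- rewrite in_itv/= leey andbT.
  by apply: nneseries_ge0 => n _ _; rewrite lee_fin powR_ge0.
- by rewrite in_itv/= leey andbT lee_fin powR_ge0.
apply: lime_le.
  by apply: is_cvg_nneseries => n _ _; rewrite lee_fin powR_ge0.
(* Discarding the index [0] gives partial sums the form [1 <= n < N.+1]. *)
exists 1%N => // -[//|N] _.
rewrite sumEFin lee_fin.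
apply: (@le_trans _ _ (\sum_(1 <= n < N.+1) weighted_mean R lambda b n `^ p)).
  apply: ler_sum => n _; apply: ge0_ler_powR; first exact: ltW.
  - by rewrite nnegrE; case: (mx_apply _ _ _) => ? ?; exact: sqrtr_ge0.
  - by rewrite nnegrE weighted_mean_ge0.
  - exact: normc_mx_apply_weighted_mean_le.
apply: le_trans
  (sum_weighted_mean_powR_le _ _ hlambda _ _ _ N hp hL0 hLp hL b0) _.
by rewrite ler_piMr ?powR_ge0.
Qed.
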